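(* Let $K$ be a field, $S=K[x_1,\ldots,x_n]$, and let $d\geq 1$ be an integer. Let $J\subsetneq I$ be two square free monomial ideals of $S$ such that $I$ is generated in degrees $\geq d$ and $J$ is generated in degrees $\geq d+1$. Let $t$ be an integer with $d\leq t\leq n$ and set $$\alpha_j=\sum_{i=0}^{j-d} (-1)^{j-d+i}\, \rho_{d+i}(I\setminus J)\qquad\text{for } d\leq j\leq t.$$ Suppose that $\operatorname{depth}_S I/J\geq t$ and $\rho_{t+1}(I\setminus J)<\alpha_t$. Then $\operatorname{depth}_S I/J=t$, independently of the characteristic of $K$ (that is, the statement holds for a field $K$ of any characteristic).
   Context: A square free monomial ideal is an ideal generated by square free monomials; the zero ideal is allowed for $J$. ''Generated in degrees $\geq d$'' means that it is generated by (square free) monomials each of degree at least $d$. For an integer $j$, $\rho_j(I\setminus J)$ denotes the number of all square free monomials of degree $j$ of $S$ that belong to $I$ but not to $J$ (so it is $0$ for $j>n$). $\operatorname{depth}_S I/J$ is the depth of the graded $S$-module $I/J$ with respect to the graded maximal ideal $(x_1,\ldots,x_n)$. *)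

(* Defs.v *)
From mathcomp Require Import all_boot all_order all_algebra.
From mathcomp Require Import boolp classical_sets.
From mathcomp Require Import mpoly.

Set Implicit Arguments.
Unset Strict Implicit.
Unset Printing Implicit Defensive.

Import GRing.Theory.
Local Open Scope ring_scope.
Local Open Scope classical_set_scope.

Section Ideals.
Variable R : comNzRingType.
Implicit Types (G I J : set R) (s : seq R).

Definition ideal_gen G : set R :=
  [set x | exists2 s : seq (R * R),
     (forall p, p \in s -> G p.2) & x = \sum_(p <- s) p.1 * p.2].

(* The ideal (s) I + J; the module (I / J) / (s)(I / J) is I / ((s) I + J). *)
Definition ideal_mul_add s I J : set R :=
  ideal_gen (J `|` [set h | exists a g, [/\ a \in s, I g & h = a * g]]).

(* [s] is a regular sequence on the module I / J, for ideals J <= I. *)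
Definition regular_seq I J s : Prop :=
  (forall k g, (k < size s)%N -> I g ->
     ideal_mul_add (take k s) I J (s`_k * g) ->
     ideal_mul_add (take k s) I J g) /\
  ~ I `<=` ideal_mul_add s I J.

(* The depth of I / J with respect to [m] is the supremum of the lengths of
   the regular sequences on I / J with all terms in [m]. *)
Definition depth_ge (m I J : set R) (r : nat) : Prop :=
  exists s, [/\ {in s, forall a, m a}, regular_seq I J s & (r <= size s)%N].

Definition depth_eq (m I J : set R) (r : nat) : Prop :=
  depth_ge m I J r /\ ~ depth_ge m I J r.+1.

End Ideals.

Section SquareFree.
Variables (K : fieldType) (n : nat).
Local Notation S := {mpoly K[n]}.
Implicit Types (I J : set S) (m : 'X_{1..n}).

Definition max_ideal : set S := ideal_gen [set 'X_i | i in [set: 'I_n]].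

Definition square_free m : bool := [forall i, (m i <= 1)%N].

Definition square_free_ideal I : Prop :=
  exists2 G : set 'X_{1..n}, G `<=` [set m | square_free m] &
    I = ideal_gen [set 'X_[m] | m in G].

Definition generated_in_degrees_ge (d : nat) I : Prop :=
  exists2 G : set 'X_{1..n},
    G `<=` [set m | square_free m /\ (d <= mdeg m)%N] &
    I = ideal_gen [set 'X_[m] | m in G].

(* 'X_{1..n < j.+1} is the finite type of monomials of degree at most j. *)
Definition rho (j : nat) I J : nat :=
  #|[set m : 'X_{1..n < j.+1} | [&& square_free m, mdeg m == j &
       `[< (I `\` J) 'X_[m] >]]]%SET|.

Definition alpha (d j : nat) I J : int :=
  \sum_(0 <= i < (j - d).+1) (-1) ^+ (j - d + i) * (rho (d + i) I J)%:Z.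

End SquareFree.

(* Main.v *)
From HB Require Import structures.
Require Import Defs.
From mathcomp Require Import all_boot all_order all_algebra.
From mathcomp Require Import boolp classical_sets.
From mathcomp Require Import mpoly.

Set Implicit Arguments.
Unset Strict Implicit.
Unset Printing Implicit Defensive.

Import GRing.Theory.
Local Open Scope ring_scope.
Local Open Scope classical_set_scope.

(** The theorem is an Euler characteristic count on one multidegree of a Koszul
    complex.

    Write x^A for the product of the variables indexed by a set A.  In
    multidegree (1, ..., 1), Koszul homology of I/J is computed by the complex
    of K-vector spaces C_d -> C_(d+1) -> ..., where C_j has for basis the
    squarefree monomials of degree j in I but not in J, so that its dimension
    is rho_j, and where x^B is sent to the signed sum of the x^A over the sets
    A obtained from B by adding one element.  Homology at C_j is a piece of
    H_(n-j)(x; I/J), or equally of the cohomology group H^j(x; I/J).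

    If I/J had a regular sequence of length t + 1 in the maximal ideal, then
    H^j(x; I/J) would vanish for all j <= t.  The complex would thus be exact
    at C_d, ..., C_t, which forces the rank of C_j -> C_(j+1) to be
    rho_j - rho_(j-1) + ... = alpha_j for d <= j <= t.  For j = t this rank is
    at most dim C_(t+1) = rho_(t+1), against rho_(t+1) < alpha_t.

    Nothing depends on the characteristic: the only facts on K-linear maps are
    rank computations.  [kos_vanish_regular] is the vanishing of Koszul
    cohomology, proved by induction along the regular sequence, without
    forming quotient modules; [strand_exact] extracts from it the exactness of
    the complex of vector spaces, and [rank_strand_diff_alpha] computes
    ranks. *)

(** * Ideals *)

Section IdealPredicate.
Variable R : comNzRingType.
Implicit Types (G I J N : set R) (s : seq R).

Definition is_ideal N : Prop :=
  [/\ N 0, forall f g, N f -> N g -> N (f + g) & forall a f, N f -> N (a * f)].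

Lemma is_idealN N f : is_ideal N -> N f -> N (- f).
Proof. by case=> _ _ NM Nf; rewrite -mulN1r; apply: NM. Qed.

Lemma is_idealB N f g : is_ideal N -> N f -> N g -> N (f - g).
Proof.
by move=> idN Nf Ng; case: (idN) => _ ND _; apply: ND => //; apply: is_idealN.
Qed.

Lemma is_ideal_sum N (T : Type) (r : seq T) (P : pred T) (F : T -> R) :
  is_ideal N -> (forall i, P i -> N (F i)) -> N (\sum_(i <- r | P i) F i).
Proof. by case=> N0 ND _ NF; elim/big_ind: _. Qed.

Lemma is_ideal_gen G : is_ideal (ideal_gen G).
Proof.
split=> [|f g [s Gs ->] [t Gt ->]|a f [s Gs ->]].
- by exists [::] => //; rewrite big_nil.
- exists (s ++ t); last by rewrite big_cat.
  by move=> p; rewrite mem_cat => /orP[/Gs|/Gt].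
- exists [seq (a * p.1, p.2) | p <- s]; first by move=> _ /mapP[p /Gs Gp ->].
  by rewrite big_map mulr_sumr; apply: eq_bigr => p _ /=; rewrite mulrA.
Qed.

Lemma sub_ideal_gen G : G `<=` ideal_gen G.
Proof.
move=> f Gf; exists [:: (1, f)]; last by rewrite big_seq1 mul1r.
by move=> p; rewrite inE => /eqP->.
Qed.

Lemma ideal_gen_sub G N : is_ideal N -> G `<=` N -> ideal_gen G `<=` N.
Proof.
move=> idN GN _ [s Gs ->]; rewrite big_seq; apply: is_ideal_sum => // p ps.
by case: idN => _ _; apply; apply/GN/Gs.
Qed.

Lemma ideal_mul_add_nil I J :
  is_ideal J -> ideal_mul_add [::] I J `<=` J.
Proof. by move=> idJ; apply: ideal_gen_sub => // f [//|[a [g []]]]. Qed.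

(** Passing from s to a longer sequence enlarges the ideal by multiples of the
    new element only; with the next two lemmas this identifies the quotient of
    I/J by the longer sequence with the quotient of I/(sI + J) by a. *)
Lemma ideal_mul_add_rcons s a I J f :
  is_ideal I -> ideal_mul_add (rcons s a) I J f ->
  exists2 g, I g & ideal_mul_add s I J (f - a * g).
Proof.
move=> [I0 ID IM]; have [N0 ND NM] : is_ideal (ideal_mul_add s I J).
  exact: is_ideal_gen.
move: f; apply: ideal_gen_sub => [|f []].
- split=> [|f h [g Ig Nf] [k Ik Nh]|b f [g Ig Nf]].
  + by exists 0 => //; rewrite mulr0 subr0.
  + exists (g + k); first exact: ID.
    by rewrite mulrDr opprD addrACA; apply: ND.
  + exists (b * g); first exact: IM.
    by rewrite mulrCA -mulrBr; apply: NM.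
- move=> Jf; exists 0 => //; rewrite mulr0 subr0.
  by apply: sub_ideal_gen; left.
- move=> [b [g [+ Ig ->]]]; rewrite mem_rcons inE => /orP[/eqP->|bs].
  + by exists g => //; rewrite subrr.
  + exists 0 => //; rewrite mulr0 subr0; apply: sub_ideal_gen; right.
    by exists b, g.
Qed.

Lemma ideal_mul_add_subl s a I J :
  ideal_mul_add s I J `<=` ideal_mul_add (rcons s a) I J.
Proof.
apply: ideal_gen_sub; first exact: is_ideal_gen.
move=> f [Jf|[b [g [bs Ig ->]]]]; apply: sub_ideal_gen; first by left.
by right; exists b, g; rewrite mem_rcons inE bs orbT.
Qed.

Lemma ideal_mul_add_last s a I J g :
  I g -> ideal_mul_add (rcons s a) I J (a * g).
Proof.
move=> Ig; apply: sub_ideal_gen; right; exists a, g.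
by rewrite mem_rcons mem_head.
Qed.

End IdealPredicate.

(** * The Koszul cochain complex *)

Section KoszulSign.
Variables (R : comNzRingType) (n : nat).
Implicit Types (A : {set 'I_n}) (i j : 'I_n).

Definition kos_sign i A : R := (-1) ^+ #|[set k in A | (k < i)%N]%SET|.

Lemma kos_sign_sq i A : kos_sign i A * kos_sign i A = 1.
Proof. by rewrite /kos_sign -exprD addnn -mul2n exprM sqrrN expr1n expr1n. Qed.

Lemma kos_signD1 i j A : j \in A ->
  kos_sign i (A :\ j) = if (j < i)%N then - kos_sign i A else kos_sign i A.
Proof.
move=> jA; rewrite /kos_sign; case: ifP => ji.
  rewrite (cardsD1 j [set k in A | _]%SET) inE jA ji exprS mulN1r opprK.
  by congr (_ ^+ _); apply: eq_card => k; rewrite !inE andbA.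
congr (_ ^+ _); apply: eq_card => k; rewrite !inE.
by case: eqP => // ->; rewrite ji !andbF.
Qed.

Lemma kos_signD1_id i A : kos_sign i (A :\ i) = kos_sign i A.
Proof.
have [iA|iA] := boolP (i \in A); first by rewrite kos_signD1 ?ltnn.
by congr kos_sign; apply/finset.setDidPl; rewrite disjoint_sym disjoints1.
Qed.

(** Removing i and then j, or j and then i, gives opposite signs: this is what
    makes the square of the differential zero. *)
Lemma kos_sign_swap i j A : i \in A -> j \in A -> i != j ->
  kos_sign i A * kos_sign j (A :\ i) = - (kos_sign j A * kos_sign i (A :\ j)).
Proof.
move=> iA jA; rewrite neq_ltn !kos_signD1 // => /orP[ij|ji].
  by rewrite ij ltnNge ltnW //= mulrN mulrC.
by rewrite ji ltnNge ltnW //= mulrN opprK mulrC.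
Qed.

(** The same sign change when i is removed and k is added, as needed for
    contraction against k to be a homotopy. *)
Lemma kos_sign_swapU i k A : i \in A -> k \notin A ->
  kos_sign k A * kos_sign i (k |: A) = - (kos_sign i A * kos_sign k (A :\ i)).
Proof.
move=> iA kA; have ik : i != k by apply: contraNneq kA => <-.
have := kos_signD1 i (finset.setU11 k A); rewrite finset.setU1K // => ->.
rewrite kos_signD1 //; case: ltngtP => [ki|_|/val_inj ki].
- by rewrite mulNr opprK mulrC.
- by rewrite mulrN opprK mulrC.
- by rewrite ki eqxx in ik.
Qed.

End KoszulSign.

Section Koszul.
Variables (R : comNzRingType) (n : nat) (x : 'I_n -> R).
Implicit Types (A : {set 'I_n}) (i j k : 'I_n) (b c : {set 'I_n} -> R).
Implicit Types (I N : set R).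

(** The whole complex is encoded by families indexed by all subsets, a cochain
    of degree p being one supported on the subsets of cardinal p. *)
Definition kos_diff c A : R :=
  \sum_(i in A) kos_sign R i A * x i * c (A :\ i).

Lemma kos_diffB b c A :
  kos_diff (fun B => b B - c B) A = kos_diff b A - kos_diff c A.
Proof. by rewrite -sumrB; apply: eq_bigr => i _; rewrite mulrBr. Qed.

Lemma kos_diffZ a c A : kos_diff (fun B => a * c B) A = a * kos_diff c A.
Proof. by rewrite mulr_sumr; apply: eq_bigr => i _; rewrite mulrCA. Qed.

Lemma kos_diff_in N c A :
  is_ideal N -> (forall B, N (c B)) -> N (kos_diff c A).
Proof.
by move=> idN Nc; apply: is_ideal_sum => // i _; case: idN => _ _; apply.
Qed.

(** Terms are paired across the diagonal, rather than deducing the vanishing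
    from S = - S, so that 2 may be a zero divisor. *)
Lemma big_offdiag_antisym (P : pred 'I_n) (F : 'I_n -> 'I_n -> R) :
  (forall i j, P i -> P j -> i != j -> F i j = - F j i) ->
  \sum_(i | P i) \sum_(j | P j && (j != i)) F i j = 0.
Proof.
move=> FN; rewrite pair_big_dep /=.
rewrite (bigID (fun p : 'I_n * 'I_n => (p.1 < p.2)%N)) /=.
rewrite [X in _ + X](reindex_inj
  (h := fun p : 'I_n * 'I_n => (p.2, p.1))) /=; last first.
  by move=> [? ?] [? ?] [-> ->].
rewrite [X in _ + X](eq_bigl (fun p : 'I_n * 'I_n =>
  [&& P p.1, P p.2 & p.2 != p.1] && (p.1 < p.2)%N)); last first.
  move=> [i j] /=; rewrite -!val_eqE /=.
  by case: (P i); case: (P j); case: ltngtP.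
rewrite -big_split big1 //= => -[i j] /= /andP[/and3P[Pi Pj ji] _].
by rewrite FN ?addNr // eq_sym.
Qed.

Lemma kos_diffK c A : kos_diff (kos_diff c) A = 0.
Proof.
pose F i j := kos_sign R i A * x i *
  (kos_sign R j (A :\ i) * x j * c (A :\ i :\ j)).
transitivity (\sum_(i in A) \sum_(j | (j \in A) && (j != i)) F i j).
  apply: eq_bigr => i _; rewrite mulr_sumr; apply: eq_bigl => j.
  by rewrite !inE andbC.
apply: big_offdiag_antisym => i j iA jA ij; rewrite /F.
have -> : A :\ j :\ i = A :\ i :\ j.
  by apply/finset.setP=> k; rewrite !inE andbCA.
rewrite -![kos_sign R _ (_ :\ _) * _ * _]mulrA ![_ * x _ * _]mulrACA.
by rewrite kos_sign_swap // mulNr; congr (- (_ * _)); rewrite mulrCA.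
Qed.

(** Contraction against the k-th basis vector. *)
Definition kos_contract k c A : R :=
  if k \in A then 0 else kos_sign R k A * c (k |: A).

(** Multiplication by a variable is null-homotopic, hence kills cohomology. *)
Lemma kos_homotopy k c A :
  kos_contract k (kos_diff c) A + kos_diff (kos_contract k c) A = x k * c A.
Proof.
rewrite {1}/kos_contract; case: ifP => [kA|/negbT kA].
  rewrite add0r /kos_diff (bigD1 k) //= big1 => [|i /andP[iA ik]]; last first.
    by rewrite /kos_contract !inE eq_sym ik kA mulr0.
  rewrite addr0 /kos_contract setD11 kos_signD1_id finset.setD1K //.
  by rewrite mulrACA kos_sign_sq mul1r.
rewrite /kos_diff big_setU1 //= finset.setU1K // mulrDr -addrA mulr_sumr.
rewrite -big_split /=.
rewrite big1 ?addr0 => [|i iA].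
  rewrite -[in kos_sign R k (k |: A)]kos_signD1_id finset.setU1K //.
  by rewrite !mulrA kos_sign_sq mul1r.
have ik : i != k by apply: contraNneq kA => <-.
rewrite /kos_contract !inE (negbTE kA) andbF.
have -> : k |: (A :\ i) = (k |: A) :\ i.
  apply/finset.setP=> l; rewrite !inE.
  by case: (eqVneq l k) => [->|] //=; rewrite eq_sym ik.
rewrite !mulrA kos_sign_swapU // !mulNr; apply/eqP.
by rewrite addrC subr_eq0; apply/eqP; congr (_ * _); rewrite mulrAC.
Qed.

(** Vanishing of the cohomology of the module I/N in degrees less than r, in
    terms of representatives in I and congruences modulo N.  The cocycle is a
    sum of cochains of various degrees; the condition on the support of b says
    that it lives in degrees less than r - 1, and is what lets the induction
    on r go through. *)
Definition kos_vanish r I N : Prop := forall c,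
  (forall A, I (c A)) -> (forall A, (r <= #|A|)%N -> c A = 0) ->
  (forall A, N (kos_diff c A)) ->
  exists b, [/\ forall A, I (b A), forall A, (r <= #|A|.+1)%N -> b A = 0
              & forall A, N (c A - kos_diff b A)].

(** The ring elements that kill a given cohomology class form an ideal, which
    contains each x i by [kos_homotopy]. *)
Lemma kos_kill r I N a c :
  is_ideal I -> is_ideal N ->
  (forall A, I (c A)) -> (forall A, (r <= #|A|)%N -> c A = 0) ->
  (forall A, N (kos_diff c A)) ->
  ideal_gen [set x i | i in [set: 'I_n]] a ->
  exists b, [/\ forall A, I (b A), forall A, (r <= #|A|.+1)%N -> b A = 0
              & forall A, N (a * c A - kos_diff b A)].
Proof.
move=> idI idN Ic c0 Nc; move: a; apply: ideal_gen_sub.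
  have [I0 ID IM] := idI; have [N0 ND NM] := idN.
  split=> [|f g [b [Ib b0 Nb]] [b' [Ib' b'0 Nb']]|a f [b [Ib b0 Nb]]].
  - exists (fun=> 0); split=> // A; rewrite mul0r sub0r.
    by apply: is_idealN => //; apply: kos_diff_in.
  - exists (fun A => b A - - b' A); split=> [A|A rA|A].
    + by rewrite opprK; apply: ID.
    + by rewrite b0 // b'0 // oppr0 subr0.
    + have -> : kos_diff (fun B => b B - - b' B) A =
          kos_diff b A + kos_diff b' A.
        rewrite -big_split; apply: eq_bigr => i _.
        by rewrite opprK mulrDr.
      by rewrite mulrDl opprD addrACA; apply: ND.
  - exists (fun A => a * b A); split=> [A|A rA|A]; first exact: IM.
      by rewrite b0 ?mulr0.
    by rewrite kos_diffZ -mulrA -mulrBr; apply: NM.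
move=> _ [k _ <-]; exists (kos_contract k c); split=> [A|A rA|A].
- rewrite /kos_contract; case: ifP => _; first by case: idI.
  by case: idI => _ _; apply.
- rewrite /kos_contract; case: ifP => // /negbT kA.
  by rewrite c0 ?mulr0 // cardsU1 kA.
- rewrite -kos_homotopy addrK /kos_contract; case: ifP => _; last first.
    by case: idN => _ _; apply.
  by case: idN.
Qed.

(** This is the long exact sequence of 0 -> M -a-> M -> M/aM -> 0 with
    M = I/N and M/aM = I/N'.  The class of c is killed by a, say a c = d b
    modulo N.  Then b is a cocycle modulo N', so b = d e + a f modulo N by
    vanishing for M/aM; applying d gives a c = a d f modulo N, and a can be
    cancelled. *)
Lemma kos_vanishS r I N N' a :
  is_ideal I -> is_ideal N -> is_ideal N' ->
  (forall f, N' f -> exists2 g, I g & N (f - a * g)) ->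
  N `<=` N' -> (forall g, I g -> N' (a * g)) ->
  (forall g, I g -> N (a * g) -> N g) ->
  ideal_gen [set x i | i in [set: 'I_n]] a ->
  kos_vanish r I N' -> kos_vanish r.+1 I N.
Proof.
move=> idI idN idN' N'_dec NN' aN' areg xa vanN' c Ic c0 Nc.
have [I0 ID IM] := idI; have [N0 ND NM] := idN; have [_ N'D N'M] := idN'.
have [b [Ib b0 Nb]] := kos_kill idI idN Ic c0 Nc xa.
have [|e [Ie e0 N'e]] := vanN' b Ib b0.
  move=> A; rewrite -(subKr (a * c A) (kos_diff b A)).
  by apply: is_idealB => //; [exact: aN' | apply: NN'].
have /choice[f Hf] : forall A, exists g,
    [/\ I g, (r <= #|A|)%N -> g = 0 & N (b A - kos_diff e A - a * g)].
  move=> A; have [Ar|rA] := ltnP #|A| r.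
    by have [g Ig Ng] := N'_dec _ (N'e A); exists g; split.
  exists 0; split=> //; rewrite b0 // mulr0 subr0 sub0r.
  rewrite /kos_diff big1 ?oppr0 // => i iA.
  by rewrite e0 ?mulr0 // (leq_trans rA) // (cardsD1 i A) iA.
(* f is a primitive of c: cancel a in a (c - d f), using d d e = 0. *)
exists f; split=> [A|A rA|A]; [by have [] := Hf A | by have [_ ->] := Hf A |].
apply: areg; first by apply: is_idealB => //; apply: kos_diff_in => // B;
  have [] := Hf B.
have -> : a * (c A - kos_diff f A) = (a * c A - kos_diff b A) +
    kos_diff (fun B => b B - kos_diff e B - a * f B) A.
  by rewrite !kos_diffB kos_diffK kos_diffZ subr0 mulrBr addrA subrK.
by apply: ND => //; apply: kos_diff_in => // B; have [] := Hf B.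
Qed.

(** The induction runs backwards along s, from the quotient by all of s, about
    which vanishing in degrees less than 0 claims nothing, to the quotient by
    no element. *)
Lemma kos_vanish_regular I J s :
  is_ideal I -> is_ideal J -> regular_seq I J s ->
  {in s, forall a, ideal_gen [set x i | i in [set: 'I_n]] a} ->
  kos_vanish (size s) I J.
Proof.
move=> idI idJ [sreg _] xs.
suff van (k : nat) : (k <= size s)%N ->
    kos_vanish (size s - k) I (ideal_mul_add (take k s) I J).
  have := van 0 (leq0n _); rewrite subn0 take0 => vanJ c Ic c0 Jc.
  have JJ : J `<=` ideal_mul_add [::] I J.
    by move=> f Jf; apply: sub_ideal_gen; left.
  have [|b [Ib b0 Jb]] := vanJ c Ic c0; first by move=> A; apply: JJ.
  by exists b; split=> // A; apply: ideal_mul_add_nil.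
have idN l : is_ideal (ideal_mul_add l I J) by apply: is_ideal_gen.
move def_m: (size s - k)%N => m; elim: m k def_m => [|m IHm] k def_m ks.
  move=> c Ic c0 Nc; have [N0 ND NM] := idN (take k s).
  exists (fun=> 0); split=> [A|//|A]; first by case: idI.
  rewrite c0 // sub0r; apply: is_idealN => //.
  exact: kos_diff_in.
have k_lt : (k < size s)%N by rewrite -subn_gt0 def_m.
have def_take := take_nth 0 k_lt.
apply: (@kos_vanishS _ _ _ (ideal_mul_add (take k.+1 s) I J) s`_k) => //.
- by rewrite def_take => f; apply: ideal_mul_add_rcons.
- by rewrite def_take; apply: ideal_mul_add_subl.
- by rewrite def_take => g; apply: ideal_mul_add_last.
- by move=> g; apply: sreg.
- by apply/xs/mem_nth.
- by apply: IHm => //; rewrite subnS def_m.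
Qed.

End Koszul.

(** * Monomial ideals *)

Section MonomialIdeals.
Variables (K : fieldType) (n : nat).
Implicit Types (m g : 'X_{1..n}) (A : {set 'I_n}) (I J : set {mpoly K[n]}).

(** Common source of two facts: a monomial ideal contains the monomials of its
    elements, and degree bounds on generators pass to all monomials. *)
Lemma mcoeff_ideal_gen (G P : set 'X_{1..n}) (f : {mpoly K[n]}) m :
  G `<=` P -> (forall m1 m2, P m2 -> P (m1 + m2)%MM) ->
  ideal_gen [set 'X_[g] | g in G] f -> f@_m != 0 -> P m.
Proof.
move=> GP Pup If; move: m; move: f If; apply: ideal_gen_sub => [|f [g Gg <-] m].
  split=> [m|f h Pf Ph m|a f Pf m]; first by rewrite mcoeff0 eqxx.
    rewrite mcoeffD; have [->|/Pf//] := eqVneq f@_m 0.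
    by rewrite add0r => /Ph.
  rewrite -mcoeff_msupp => /msuppM_le /allpairsP[[m1 m2] /= [_]].
  by rewrite mcoeff_msupp => /Pf Pm2 ->; apply: Pup.
by rewrite mcoeffX; case: (eqVneq g m) => [<- _|_]; [apply: GP | rewrite eqxx].
Qed.

Lemma square_free_ideal_is_ideal I : square_free_ideal I -> is_ideal I.
Proof. by move=> [G _ ->]; apply: is_ideal_gen. Qed.

Lemma square_free_ideal_mcoeff I f m :
  square_free_ideal I -> I f -> f@_m != 0 -> I 'X_[m].
Proof.
move=> sfI; have [_ _ IM] := square_free_ideal_is_ideal sfI.
case: sfI IM => G _ -> IM; apply: (@mcoeff_ideal_gen G (fun m => _ 'X_[m])).
  by move=> g Gg; apply: sub_ideal_gen; exists g.
by move=> m1 m2 Im2; rewrite mpolyXD; apply: IM.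
Qed.

Lemma generated_in_degrees_ge_mdeg d I m :
  generated_in_degrees_ge d I -> I 'X_[m] -> (d <= mdeg m)%N.
Proof.
move=> [G Gd ->] Im.
apply: (mcoeff_ideal_gen (P := fun g => (d <= mdeg g)%N) _ _ Im).
- by move=> g /Gd[].
- by move=> m1 m2 dm2; rewrite mdegD (leq_trans dm2) ?leq_addl.
- by rewrite mcoeffX eqxx oner_eq0.
Qed.

Lemma mesym1D1 i A : i \in A -> mesym1 A = (U_(i) + mesym1 (A :\ i))%MM.
Proof.
move=> iA; apply/mnmP=> k; rewrite mnmDE mnm1E !mnmE !inE eq_sym.
by case: eqVneq => [->|_]; rewrite ?iA.
Qed.

Lemma square_free_mesym1 m : square_free m -> exists A, m = mesym1 A.
Proof.
move=> /forallP sfm; exists [set i | m i != 0%N]%SET; apply/mnmP=> i.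
by rewrite mnmE inE; case: (m i) (sfm i) => [|[]].
Qed.

(** The squarefree monomials of degree j in I but not in J, as subsets of the
    variables: these index a basis of the j-th term of the complex. *)
Definition cell I J j : {set {set 'I_n}} :=
  [set A : {set 'I_n} | (#|A| == j) && `[< (I `\` J) 'X_[mesym1 A] >]]%SET.

Lemma cellP I J j A :
  reflect [/\ #|A| = j, I 'X_[mesym1 A] & ~ J 'X_[mesym1 A]] (A \in cell I J j).
Proof.
by rewrite inE; apply: (iffP andP) => [[/eqP-> /asboolP[]]|[-> IA JA]];
  split=> //; apply/asboolP.
Qed.

Lemma card_cell I J j : #|cell I J j| = rho j I J.
Proof.
rewrite /rho [RHS]cardE -(size_map (@bmnm n j.+1)) cardE.
rewrite -(size_map (@mesym1 n)); apply: perm_size; apply: uniq_perm.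
- by rewrite map_inj_uniq ?enum_uniq //; apply: inj_mesym1.
- by rewrite map_inj_uniq ?enum_uniq //; apply: val_inj.
move=> m; apply/mapP/mapP=> [[A]|[b]]; rewrite mem_enum.
  move=> /cellP[jA IA JA] ->.
  have lt : (mdeg (mesym1 A) < j.+1)%N by rewrite mdeg_mesym1 jA.
  exists (BMultinom lt); rewrite // mem_enum inE /= mdeg_mesym1 jA eqxx /=.
  apply/andP; split; last exact/asboolP.
  by apply/forallP=> i; rewrite mnmE leq_b1.
rewrite inE => /and3P[/square_free_mesym1[A bA] /eqP jb /asboolP[Ib Jb] ->].
exists A => //; rewrite mem_enum; apply/cellP.
by rewrite -mdeg_mesym1 -bA.
Qed.

End MonomialIdeals.

(** * The squarefree strand *)

Section ExactRank.
Variables (K : fieldType).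

Lemma dim_ffun (T : finType) : \dim {: {ffun T -> K^o}} = #|T|.
Proof. by rewrite dimvf /dim /= muln1. Qed.

Lemma exact_rank (U V W : vectType K) (f : 'Hom(U, V)) (g : 'Hom(V, W)) :
  (forall u, g (f u) = 0) -> (forall v, g v = 0 -> exists u, v = f u) ->
  (\dim (limg f) + \dim (limg g) = \dim {: V})%N.
Proof.
move=> gf0 gfE; rewrite -(limg_ker_dim g fullv) capfv; congr (\dim _ + _)%N.
apply/eqP; rewrite eqEsubv; apply/andP; split; apply/subvP=> v.
  by move=> /memv_imgP[u _ ->]; rewrite memv_ker gf0.
by rewrite memv_ker => /eqP/gfE[u ->]; apply: memv_img; apply: memvf.
Qed.

End ExactRank.

Lemma kos_sign_morph (R R' : comNzRingType) (f : {rmorphism R -> R'}) n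
    (i : 'I_n) (A : {set 'I_n}) : f (kos_sign R i A) = kos_sign R' i A.
Proof. by rewrite rmorphXn rmorphN1. Qed.

Section Strand.
Variables (K : fieldType) (n : nat) (I J : set {mpoly K[n]}).
Hypotheses (sfI : square_free_ideal I) (sfJ : square_free_ideal J).
Implicit Types (A B : {set 'I_n}) (i : 'I_n) (j : nat).

Let X A : {mpoly K[n]} := 'X_[mesym1 A].
Definition cells j := {A : {set 'I_n} | A \in cell I J j}.
Definition strand j := {ffun cells j -> K^o}.

Definition extend j (y : strand j) A : K := oapp y 0 (insub A).

Lemma extend_val j (y : strand j) (u : cells j) : extend y (val u) = y u.
Proof. by rewrite /extend valK. Qed.

Lemma extend_out j (y : strand j) A : A \notin cell I J j -> extend y A = 0.
Proof. by move=> jA; rewrite /extend insubN. Qed.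

(** Dividing by x^A in each multidegree A turns multiplication by the variables
    into multiplication by 1, whence the scalar Koszul differential. *)
Definition strand_fun j (y : strand j) : strand j.+1 :=
  [ffun u => kos_diff (fun=> 1) (extend y) (val u)].

Lemma strand_fun_linear j : linear (@strand_fun j).
Proof.
move=> a y z; apply/ffunP=> u; rewrite !ffunE.
rewrite [a *: kos_diff _ _ _]mulr_sumr -big_split; apply: eq_bigr => i _ /=.
rewrite mulrCA -mulrDr; congr (_ * _); rewrite /extend.
by case: insubP => [v _ _|_] /=; rewrite ?ffunE ?mulr0 ?addr0.
Qed.

HB.instance Definition _ j := GRing.isLinear.Build K (strand j) (strand j.+1)
  _ (@strand_fun j) (@strand_fun_linear j).

Definition strand_diff j : 'Hom(strand j, strand j.+1) :=
  linfun (@strand_fun j).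

Lemma mul_Xset i A : i \in A -> X A = 'X_i * X (A :\ i).
Proof. by move=> iA; rewrite /X (mesym1D1 iA) mpolyXD. Qed.

Lemma Xset_in (N : set {mpoly K[n]}) i A :
  square_free_ideal N -> i \in A -> N (X (A :\ i)) -> N (X A).
Proof.
move=> /square_free_ideal_is_ideal[_ _ NM] iA NAi.
by rewrite (mul_Xset iA); apply: NM.
Qed.

(** Truncation to cells can lose values only where x^A is in J: if A has the
    wrong cardinal, or if x^A is not in I and hence neither are its divisors,
    then both sides are zero. *)
Lemma extend_strand_diff j (y : strand j) A :
  ~ J (X A) -> extend (strand_diff j y) A = kos_diff (fun=> 1) (extend y) A.
Proof.
move=> JA; have [jA|jA] := boolP (A \in cell I J j.+1).
  by rewrite -[A in LHS](SubK (cells j.+1) jA) extend_val lfunE /= ffunE.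
rewrite extend_out // [RHS]big1 // => i iA; rewrite extend_out ?mulr0 //.
apply: contra jA => /cellP[jAi IAi _]; apply/cellP; split=> //.
  by rewrite (cardsD1 i) iA jAi.
exact: Xset_in IAi.
Qed.

Lemma strand_diffK j (y : strand j) : strand_diff j.+1 (strand_diff j y) = 0.
Proof.
apply/ffunP=> u; have /cellP[_ _ JA] := valP u.
rewrite -extend_val extend_strand_diff // ffunE.
rewrite -[RHS](kos_diffK (fun=> 1) (extend y) (val u)).
apply: eq_bigr => i iA; rewrite extend_strand_diff // => /Xset_in.
by move=> /(_ sfJ iA).
Qed.

(** Taking the coefficient of x^A at each A turns Koszul cochains over the
    polynomial ring with respect to the variables into scalar cochains. *)
Lemma mcoeff_kos_diff (b : {set 'I_n} -> {mpoly K[n]}) A :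
  (kos_diff (fun i => 'X_i) b A)@_(mesym1 A) =
  kos_diff (fun=> 1) (fun B => (b B)@_(mesym1 B)) A.
Proof.
rewrite raddf_sum; apply: eq_bigr => i iA /=.
rewrite mulr1 -mulrA -(kos_sign_morph (@mpolyC n K)) mcoeffCM mulrC.
by rewrite [_ * b _]mulrC (mesym1D1 iA) mcoeffMX mulrC.
Qed.

(** A cocycle y of scalars yields the cochain y_A x^A with values in I, which
    is a cocycle modulo J.  It is a coboundary of some b by hypothesis, and the
    coefficients of x^A in b_A give a primitive of y. *)
Lemma strand_exact r j (y : strand j.+1) :
  kos_vanish (fun i => 'X_i) r I J -> (j.+1 < r)%N -> strand_diff j.+1 y = 0 ->
  exists z, y = strand_diff j z.
Proof.
move=> vanJ jr dy0; have [J0 _ JM] := square_free_ideal_is_ideal sfJ.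
have [I0 _ IM] := square_free_ideal_is_ideal sfI.
pose c A := (extend y A)%:MP * X A.
have y0 A : A \notin cell I J j.+1 -> c A = 0.
  by move=> jA; rewrite /c extend_out // mul0r.
have dc A : kos_diff (fun i => 'X_i) c A =
    (kos_diff (fun=> 1) (extend y) A)%:MP * X A.
  rewrite rmorph_sum mulr_suml; apply: eq_bigr => i iA; rewrite /c.
  rewrite (mul_Xset iA) mulr1 rmorphM /= kos_sign_morph -!mulrA.
  by congr (_ * _); rewrite mulrCA.
have [A|A rA|A|b [Ib _ Jb]] := vanJ c.
- have [/cellP[_ IA _]|/y0->//] := boolP (A \in cell I J j.+1).
  exact: IM.
- by apply: y0; apply: contraL rA => /cellP[-> _ _]; rewrite -ltnNge.
- rewrite dc; have [JA|JA] := pselect (J (X A)); first exact: JM.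
  by rewrite -extend_strand_diff // dy0 /extend; case: insub => [u|] /=;
    rewrite ?ffunE mpolyC0 mul0r.
pose z : strand j := [ffun u => (b (val u))@_(mesym1 (val u))].
(* Modulo J, c = d b; compare coefficients at a monomial that is not in J. *)
exists z; apply/ffunP=> u; have /cellP[uj Iu Ju] := valP u.
rewrite -[RHS]extend_val extend_strand_diff //.
transitivity (kos_diff (fun=> 1) (fun B => (b B)@_(mesym1 B)) (val u)).
  apply/eqP; rewrite -mcoeff_kos_diff -subr_eq0.
  have -> : y u = (c (val u))@_(mesym1 (val u)).
    by rewrite mcoeffCM mcoeffX eqxx mulr1 extend_val.
  rewrite -mcoeffB; apply/negPn/negP => /(square_free_ideal_mcoeff sfJ (Jb _)).
  exact: Ju.
apply: eq_bigr => i iu; congr (_ * _).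
have [ju|ju] := boolP (val u :\ i \in cell I J j).
  by rewrite -[val u :\ i](SubK (cells j) ju) extend_val ffunE.
rewrite extend_out //; apply/eqP/negPn/negP => bi; move/negP: ju; apply.
apply/cellP; split; last by move/(Xset_in sfJ iu).
  by move: uj; rewrite (cardsD1 i (val u)) iu => -[].
exact: square_free_ideal_mcoeff (Ib _) bi.
Qed.


Lemma dim_strand j : \dim {: strand j} = rho j I J.
Proof.
by rewrite dim_ffun card_sig -card_cell; apply: eq_card => A; rewrite inE.
Qed.

Lemma rank_strand_diff r j :
  kos_vanish (fun i => 'X_i) r I J -> (j.+1 < r)%N ->
  (\dim (limg (strand_diff j)) + \dim (limg (strand_diff j.+1)) =
   rho j.+1 I J)%N.
Proof.
move=> vanJ jr; rewrite -dim_strand; apply: exact_rank => [y|y].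
  exact: strand_diffK.
exact: (strand_exact vanJ jr).
Qed.

End Strand.

Lemma alphaS (K : fieldType) (n d j : nat) (I J : set {mpoly K[n]}) :
  (d <= j)%N ->
  alpha d j.+1 I J = (rho j.+1 I J)%:Z - alpha d j I J.
Proof.
move=> dj; rewrite /alpha subSn // big_nat_recr //=.
rewrite [(d + _.+1)%N]addnS subnKC //.
rewrite addnn -mul2n exprM sqrrN !expr1n mul1r addrC -sumrN; congr (_ + _).
by apply: eq_bigr => i _; rewrite addSn exprS mulN1r mulNr.
Qed.

Lemma rho_lt_degree (K : fieldType) (n d j : nat) (I J : set {mpoly K[n]}) :
  generated_in_degrees_ge d I -> (j < d)%N -> rho j I J = 0%N.
Proof.
move=> Id jd; rewrite -card_cell; apply/eqP; rewrite cards_eq0 -finset.subset0.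
apply/fintype.subsetP=> A /cellP[jA /(generated_in_degrees_ge_mdeg Id)].
by rewrite mdeg_mesym1 jA leqNgt jd.
Qed.

(** The bound on the degrees of I is written d.+1 so that the complex has a zero
    term in degree d, at which the recursion for the ranks starts. *)
Lemma rank_strand_diff_alpha (K : fieldType) (n d j r : nat)
    (I J : set {mpoly K[n]}) :
  square_free_ideal I -> square_free_ideal J ->
  generated_in_degrees_ge d.+1 I -> kos_vanish (fun i => 'X_i) r I J ->
  (d < j < r)%N ->
  (\dim (limg (strand_diff I J j)))%:Z = alpha d.+1 j I J.
Proof.
move=> sfI sfJ Id vanJ; elim: j => [|j IHj] // /andP[dj jr].
have rankj := rank_strand_diff sfI sfJ vanJ jr.
move: dj; rewrite ltnS leq_eqVlt => /orP[/eqP def_d|dj].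
  have: (\dim (limg (strand_diff I J j)) <= 0)%N.
    rewrite -(rho_lt_degree J Id (ltnSn d)) def_d -dim_strand.
    by rewrite -(limg_ker_dim (strand_diff I J j) fullv) leq_addl.
  rewrite leqn0 => /eqP rank0; move: rankj; rewrite rank0 add0n => ->.
  by rewrite /alpha def_d subnn big_nat1 mul1r addn0.
rewrite alphaS // -IHj ?dj ?(ltnW jr) // -rankj PoszD.
by rewrite addrAC subrr add0r.
Qed.

Theorem theorem1p3 (K : fieldType) (n d t : nat) (I J : set {mpoly K[n]})
    (hd : (1 <= d)%N)
    (hI : square_free_ideal I) (hJ : square_free_ideal J) (hJI : J `<` I)
    (hId : generated_in_degrees_ge d I)
    (hJd : generated_in_degrees_ge d.+1 J)
    (hdt : (d <= t)%N) (htn : (t <= n)%N)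
    (hdepth : depth_ge (@max_ideal K n) I J t)
    (hrho : (rho t.+1 I J)%:Z < alpha d t I J) :
  depth_eq (@max_ideal K n) I J t.
Proof.
split=> // -[s [s_max s_reg ts]].
have vanJ := kos_vanish_regular (square_free_ideal_is_ideal hI)
  (square_free_ideal_is_ideal hJ) s_reg s_max.
case: d hd hId hJd hdt hrho => // d _ hId _ dt.
rewrite -(rank_strand_diff_alpha hI hJ hId vanJ) ?dt // ltz_nat ltnNge.
by rewrite -dim_strand dimvS ?subvf.
Qed.
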